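(* Let $n\ge 1$ be an integer, let $\alpha>0$ be real and let $k$ be a positive integer with $0<k\alpha\le 1<(k+1)\alpha$, let $\delta>0$ and $t_0>0$. Let $A_0$ be a constant $n\times n$ matrix in Jordan canonical form all of whose eigenvalues are real, let $A_1(t),\dots,A_k(t)$ be $n\times n$ matrices of class $\Sigma$, and let $F(t)$ be an $n\times n$ matrix function with $\|F(t)\|\le C<\infty$ for $t_0\le t<\infty$. Consider the system $$\frac{dx}{dt}=\Bigl\{A_0+\sum_{j=1}^k\frac{1}{t^{j\alpha}}A_j(t)\Bigr\}x+\frac{1}{t^{1+\delta}}F(t)x. \qquad ( * )$$ Then there exist constant $n\times n$ matrices $A_1,\dots,A_k$, $n\times n$ matrices $Y_1(t),\dots,Y_k(t)$ of class $\Sigma$ with zero mean value, numbers $t^*>t_0$, $\varepsilon>0$, $C_1<\infty$, and an $n\times n$ matrix function $G(t)$ with $\|G(t)\|\le C_1$ for $t>t^*$, such that, with $Y_0(t)=I$ (the identity matrix), the matrix $\sum_{j=0}^k t^{-j\alpha}Y_j(t)$ is invertible for all $t>t^*$ and the change of variables $$x=\Bigl\{\sum_{j=0}^k\frac{1}{t^{j\alpha}}Y_j(t)\Bigr\}y$$ transforms system $( * )$, for $t>t^*$, into the system $$\frac{dy}{dt}=\Bigl\{\sum_{j=0}^k\frac{1}{t^{j\alpha}}A_j\Bigr\}y+\frac{1}{t^{1+\varepsilon}}G(t)y,$$ where $A_0$ is the same matrix as in $( * )$.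
   Context: A square matrix function of $t$ is of class $\Sigma$ if each of its elements is a trigonometric polynomial, i.e. a finite sum $\sum_{j} b_j e^{i\lambda_j t}$ with complex coefficients $b_j$ and arbitrary real frequencies $\lambda_j$. The mean (mean value) of a matrix of class $\Sigma$ is the constant matrix consisting of the constant terms ($\lambda_j=0$) of its elements. $\|\cdot\|$ is some fixed matrix norm on $n\times n$ matrices. Matrices and solutions may have complex entries. The constant matrices $A_j$ ($j\ge1$, no argument) are distinct objects from the given matrix functions $A_j(t)$. ''Transforms into'' means that $x(t)$ solves the first system for $t>t^*$ if and only if the corresponding $y(t)$ solves the second. *)

(* Defs.v *)
From HB Require Import structures.
From mathcomp Require Import all_boot all_order all_algebra.
From mathcomp Require Import all_classical all_reals all_analysis.
From mathcomp Require Import complex.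

Set Implicit Arguments.
Unset Strict Implicit.
Unset Printing Implicit Defensive.

Import Order.TTheory GRing.Theory Num.Theory.
Import numFieldNormedType.Exports.

Local Open Scope classical_set_scope.
Local Open Scope ring_scope.
Local Open Scope complex_scope.

Definition expi {R : realType} (x : R) : R[i] := cos x +i* sin x.

(* A trigonometric polynomial is given by the list of its terms (b, lambda),
   standing for t |-> b * exp (i * lambda * t). A frequency may be repeated, so
   that the constant term is a sum; since the functions exp (i * lambda * t) are
   linearly independent, it depends only on the function trig_eval p. *)
Definition trig_poly (R : realType) := seq (R[i] * R).

Definition trig_eval {R : realType} (p : trig_poly R) (t : R) : R[i] :=
  \sum_(bl <- p) bl.1 * expi (bl.2 * t).

Definition trig_const_term {R : realType} (p : trig_poly R) : R[i] :=
  \sum_(bl <- p | bl.2 == 0) bl.1.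

Definition class_Sigma {R : realType} {n : nat} (M : R -> 'M[R[i]]_n) : Prop :=
  forall a b, exists p : trig_poly R, forall t, M t a b = trig_eval p t.

Definition has_mean {R : realType} {n : nat}
    (M : R -> 'M[R[i]]_n) (M0 : 'M[R[i]]_n) : Prop :=
  forall a b, exists p : trig_poly R,
    (forall t, M t a b = trig_eval p t) /\ trig_const_term p = M0 a b.

(* Submultiplicativity is not required. *)
Record matrix_norm {R : realType} {n : nat} (N : 'M[R[i]]_n -> R) : Prop :=
  MatrixNorm {
    mxnorm_ge0 : forall A, 0 <= N A;
    mxnorm_eq0 : forall A, N A = 0 -> A = 0;
    mxnorm_scale : forall (c : R[i]) A, (N (c *: A))%:C = `|c| * (N A)%:C;
    mxnorm_triangle : forall A B, N (A + B) <= N A + N B }.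

Definition jordan_block {K : fieldType} (p : nat) (a : K) : 'M[K]_p :=
  \matrix_(i, j) (if i == j then a else if i.+1 == j :> nat then 1 else 0).

Definition jordan_form {K : fieldType} {n : nat} (A : 'M[K]_n) : Prop :=
  exists (s : nat) (p : 'I_s -> nat) (a : 'I_s -> K)
    (e : (\sum_(l < s) p l)%N = n),
    (forall l, (0 < p l)%N) /\
    A = castmx (e, e) (\mxdiag_(l < s) jordan_block (p l) (a l)).

(* The library's is_derive needs a normed module over R, which R[i] is not; the
   limit is taken in the topology of R[i] as a numFieldType. *)
Definition has_deriv {R : realType} (f : R -> R[i]) (t : R) (d : R[i]) : Prop :=
  ((h^-1)%:C * (f (t + h) - f t) : (R[i] : numFieldType)) @[h --> (0 : R)^']
    --> (d : (R[i] : numFieldType)).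

Definition solves {R : realType} {n : nat} (T : R)
    (f : R -> 'cV[R[i]]_n -> 'cV[R[i]]_n) (x : R -> 'cV[R[i]]_n) : Prop :=
  forall t, T < t ->
    forall a, has_deriv (fun s => x s a 0) t (f t (x t) a 0).

(* Main.v *)
Require Import Defs.
From mathcomp Require Import all_boot all_order all_algebra.
From mathcomp Require Import all_classical all_reals all_analysis.
From mathcomp Require Import complex.
From mathcomp Require Import ring lra perm.
Import Order.TTheory GRing.Theory Num.Theory.
Import numFieldNormedType.Exports ComplexField.Normc.
Local Open Scope ring_scope.
Local Open Scope complex_scope.

Set Implicit Arguments.
Unset Strict Implicit.
Unset Printing Implicit Defensive.

(** Write w_j(t) = t^(-j alpha), let B_0 be the constant A0 and B_j = A_j(t) for
    1 <= j <= k, and let P be the sum of the w_j Y_j and A the sum of the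
    w_j A_j. The change of variables x = P y replaces the coefficient B of the
    first system by P^-1 (B P - P'). So one wants B P - P' - P A to be small.

    Up to products w_i w_j with i + j > k and up to the derivatives of the
    weights, this difference vanishes as soon as, for every j <= k,
      Y_j' = sum over i <= j of (B_(j-i) Y_i - Y_i A_(j-i)).
    The extreme terms of that sum are A0 Y_j - Y_j A0 and B_j - A_j, so the
    equations can be solved recursively ([formal_solution]): at step j one has
      Y' = A0 Y - Y A0 + Q - M
    with Q a known trigonometric polynomial, to be solved for the constant M and
    for Y of mean zero ([homological_equation]). The mean of Q is M. At a
    frequency l <> 0 the coefficient of Y is obtained by inverting
    i l - [A0, . ]; by Sylvester's criterion this operator is invertible, because
    A0 and A0 + i l have no common eigenvalue: the spectrum of A0 is real.

    What remains of B P - P' - P A is a sum of terms of three kinds: those with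
    weight w_(i+j), i + j > k, which are O(t^(-(k+1) alpha)); those with the
    derivative of a weight, which are O(t^(-1-alpha)); and t^(-1-delta) F P.
    All are O(t^(-1-eps)) for eps the minimum of (k+1) alpha - 1, alpha and
    delta. Since P = I + O(t^(-alpha)), the inverse of P exists and is bounded
    for large t, and G is t^(1+eps) P^-1 times the remainder.

    The given norm is arbitrary, while products are estimated with the sum of the
    moduli of the entries, which is submultiplicative; the two are compared by
    compactness of the unit sphere ([matrix_norm_equiv]). *)

(** * Derivatives of complex-valued functions of a real variable *)

Lemma normcE_real {R : rcfType} (z : R[i]) : `|z| = (normc z)%:C.
Proof. by rewrite normc_def; case: z. Qed.

Lemma Re_le_normc {R : rcfType} (z : R[i]) : `|complex.Re z| <= normc z.
Proof.
case: z => a b /=.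
by rewrite -sqrtr_sqr ler_sqrt ?addr_ge0 ?sqr_ge0// lerDl sqr_ge0.
Qed.

Lemma Im_le_normc {R : rcfType} (z : R[i]) : `|complex.Im z| <= normc z.
Proof.
case: z => a b /=.
by rewrite -sqrtr_sqr ler_sqrt ?addr_ge0 ?sqr_ge0// lerDr sqr_ge0.
Qed.

Lemma normc_le_ReIm {R : rcfType} (z : R[i]) :
  normc z <= `|complex.Re z| + `|complex.Im z|.
Proof.
case: z => a b /=.
have h : 0 <= `|a| + `|b| by rewrite addr_ge0.
rewrite -(ger0_norm h) -(sqrtr_sqr (`|a| + `|b|)) ler_sqrt ?sqr_ge0// sqrrD !real_normK ?num_real//.
by rewrite -addrA lerD2l lerDr mulrn_wge0 ?mulr_ge0.
Qed.

Section ComponentwiseDerivative.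
Context {R : realType}.
Local Open Scope classical_set_scope.
Local Open Scope ring_scope.

Let ReB (z w : R[i]) : complex.Re (z - w) = complex.Re z - complex.Re w.
Proof. by case: z w => ? ? []. Qed.

Let ImB (z w : R[i]) : complex.Im (z - w) = complex.Im z - complex.Im w.
Proof. by case: z w => ? ? []. Qed.

(** The modulus is at least the absolute value of each coordinate and at most
    the sum of the two. *)
Lemma cvg_complexP {T : Type} (F : set_system T) {FF : Filter F}
    (f : T -> R[i]) (d : R[i]) :
  ((f x : (R[i] : numFieldType)) @[x --> F] --> (d : (R[i] : numFieldType)))
  <-> (complex.Re (f x) @[x --> F] --> complex.Re d) /\
      (complex.Im (f x) @[x --> F] --> complex.Im d).
Proof.
split=> [/cvgrPdist_lt cf|[/cvgrPdist_lt cR /cvgrPdist_lt cI]].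
  have key (e : R) : 0 < e -> \forall x \near F, normc (d - f x) < e.
    move=> e0; have := cf e%:C; rewrite ltcR => /(_ e0).
    by apply: filterS => x; rewrite normcE_real ltcR.
  split; apply/cvgrPdist_lt => e /key; apply: filterS => x; apply: le_lt_trans.
    by rewrite -ReB Re_le_normc.
  by rewrite -ImB Im_le_normc.
apply/cvgrPdist_lt => -[e e']; rewrite ltcE/= => /andP[/eqP -> e0].
have e20 : 0 < e / 2 by rewrite divr_gt0.
near=> x.
rewrite normcE_real -[_ +i* 0]/(e%:C) ltcR (le_lt_trans (normc_le_ReIm _))//.
rewrite (splitr e) ltrD//.
  rewrite ReB; near: x; exact: cR.
rewrite ImB; near: x; exact: cI.
Unshelve. all: by end_near. Qed.

Lemma is_derive1P (f : R -> R) (t d : R) :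
  is_derive t 1 f d <-> h^-1 * (f (t + h) - f t) @[h --> 0^'] --> d.
Proof.
have -> : (fun h => h^-1 * (f (t + h) - f t)) =
          (fun h => h^-1 *: ((f \o shift t) (h *: (1 : R)) - f t)).
  by apply/funext => h /=; rewrite /shift/= -[h *: 1]/(h * 1) mulr1 (addrC t).
split=> [[df <-]|cf]; first exact: df.
by apply: DeriveDef; [apply/cvg_ex; exists d|apply/cvg_lim].
Qed.

(** Reduces the complex difference quotient to real derivatives, so
    that the calculus of real functions applies coordinatewise. *)
Lemma has_derivP (f : R -> R[i]) (t : R) (d : R[i]) :
  has_deriv f t d <->
  is_derive t 1 (fun s => complex.Re (f s)) (complex.Re d) /\
  is_derive t 1 (fun s => complex.Im (f s)) (complex.Im d).
Proof.
rewrite /has_deriv cvg_complexP !is_derive1P.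
have eR (h : R) (z w : R[i]) : complex.Re (h%:C * (z - w)) =
    h * (complex.Re z - complex.Re w).
  by case: z w => ? ? [? ?] /=; ring.
have eI (h : R) (z w : R[i]) : complex.Im (h%:C * (z - w)) =
    h * (complex.Im z - complex.Im w).
  by case: z w => ? ? [? ?] /=; ring.
by under eq_cvg do rewrite eR; under [X in _ /\ X <-> _]eq_cvg do rewrite eI.
Qed.

End ComponentwiseDerivative.

Section HasDeriv.
Context {R : realType}.
Implicit Types (f g : R -> R[i]) (t : R).

Let ReD (z w : R[i]) : complex.Re (z + w) = complex.Re z + complex.Re w.
Proof. by case: z w => ? ? []. Qed.

Let ImD (z w : R[i]) : complex.Im (z + w) = complex.Im z + complex.Im w.
Proof. by case: z w => ? ? []. Qed.

Lemma has_deriv_unique f t d e : has_deriv f t d -> has_deriv f t e -> d = e.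
Proof.
move=> /has_derivP[[_ d1] [_ d2]] /has_derivP[[_ e1] [_ e2]].
by apply/eqP; rewrite eq_complex -d1 -d2 e1 e2 !eqxx.
Qed.

Lemma has_deriv_near f g t d : (\forall s \near t, f s = g s) ->
  has_deriv f t d -> has_deriv g t d.
Proof.
move=> fg /has_derivP[hR hI]; apply/has_derivP.
split; [apply: near_eq_is_derive hR|apply: near_eq_is_derive hI] => //;
  by apply: filterS fg => s ->.
Qed.

Lemma has_deriv_ext f g t d : f =1 g -> has_deriv f t d -> has_deriv g t d.
Proof. by move=> /funext ->. Qed.

Lemma has_deriv_cst (c : R[i]) t : has_deriv (fun=> c) t 0.
Proof. by apply/has_derivP; split; exact: is_derive_cst. Qed.

Lemma has_derivD f g t df dg : has_deriv f t df -> has_deriv g t dg ->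
  has_deriv (fun s => f s + g s) t (df + dg).
Proof.
move=> /has_derivP[fR fI] /has_derivP[gR gI]; apply/has_derivP; split.
  rewrite ReD.
  have -> : (fun s => complex.Re (f s + g s)) =
    (fun s => complex.Re (f s)) \+ (fun s => complex.Re (g s)).
    by apply/funext => s; rewrite ReD.
  exact: is_deriveD.
rewrite ImD.
have -> : (fun s => complex.Im (f s + g s)) =
  (fun s => complex.Im (f s)) \+ (fun s => complex.Im (g s)).
  by apply/funext => s; rewrite ImD.
exact: is_deriveD.
Qed.

Lemma has_derivM f g t df dg : has_deriv f t df -> has_deriv g t dg ->
  has_deriv (fun s => f s * g s) t (df * g t + f t * dg).
Proof.
move=> /has_derivP[fR fI] /has_derivP[gR gI]; apply/has_derivP.
have eR z w : complex.Re (z * w) = complex.Re z * complex.Re w - complex.Im z * complex.Im w :> R.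
  by case: z w => ? ? [? ?].
have eI z w : complex.Im (z * w) = complex.Re z * complex.Im w + complex.Im z * complex.Re w :> R.
  by case: z w => ? ? [? ?].
split.
  have -> : (fun s => complex.Re (f s * g s)) =
     ((fun s => complex.Re (f s)) * (fun s => complex.Re (g s))) -
     ((fun s => complex.Im (f s)) * (fun s => complex.Im (g s))).
    by apply/funext => s; rewrite eR.
  apply: is_derive_eq (is_deriveB (is_deriveM fR gR) (is_deriveM fI gI)) _.
  rewrite ReD !eR /GRing.scale/=; ring.
have -> : (fun s => complex.Im (f s * g s)) =
   ((fun s => complex.Re (f s)) * (fun s => complex.Im (g s))) +
   ((fun s => complex.Im (f s)) * (fun s => complex.Re (g s))).
  by apply/funext => s; rewrite eI.
apply: is_derive_eq (is_deriveD (is_deriveM fR gI) (is_deriveM fI gR)) _.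
rewrite ImD !eI /GRing.scale/=; ring.
Qed.

Lemma has_deriv_sum (I : Type) (r : seq I) (P : pred I) (f : I -> R -> R[i]) t df :
  (forall i, P i -> has_deriv (f i) t (df i)) ->
  has_deriv (fun s => \sum_(i <- r | P i) f i s) t (\sum_(i <- r | P i) df i).
Proof.
move=> hf; elim: r => [|i r IH].
  by rewrite big_nil; apply: has_deriv_ext (has_deriv_cst 0 t) => s; rewrite big_nil.
rewrite big_cons; case: ifPn => Pi.
  apply: has_deriv_ext (has_derivD (hf i Pi) IH) => s.
  by rewrite big_cons Pi.
by apply: has_deriv_ext IH => s; rewrite big_cons (negPf Pi).
Qed.

Lemma has_deriv_real (f : R -> R) t (d : R) :
  is_derive t 1 f d -> has_deriv (fun s => (f s)%:C) t d%:C.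
Proof. by move=> fd; apply/has_derivP; split => //=; exact: is_derive_cst. Qed.

(** Only differentiability matters here: the derivative of an inverse
    matrix is recovered later from the product rule and uniqueness. *)
Lemma has_derivV f t d : f t != 0 -> has_deriv f t d ->
  exists e, has_deriv (fun s => (f s)^-1) t e.
Proof.
move=> ft0 /has_derivP[fR fI].
pose q s := complex.Re (f s) ^+ 2 + complex.Im (f s) ^+ 2.
have qE : q = (fun s => complex.Re (f s)) ^+ 2 + (fun s => complex.Im (f s)) ^+ 2.
  by apply/funext => s; rewrite /q.
have q0 : q t != 0.
  apply: contra ft0; rewrite /q paddr_eq0 ?sqr_ge0// !sqrf_eq0 => /andP[a0 b0].
  by rewrite eq_complex a0 b0.
have [dq qd] : exists dq, is_derive t 1 q dq.
  by eexists; rewrite qE; exact: is_deriveD.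
have qV := is_deriveV q0 qd.
have [dR RD] : exists e, is_derive t 1 (fun s => complex.Re (f s) * (q s)^-1) e.
  by eexists; exact: (is_deriveM fR qV).
have [dI ID] : exists e, is_derive t 1 (fun s => (- complex.Im (f s)) * (q s)^-1) e.
  by eexists; exact: (is_deriveM (is_deriveN fI) qV).
exists (dR +i* dI); apply/has_derivP => /=; split.
  move: RD; congr (is_derive _ _ _ _); apply/funext => s; rewrite /q.
  by case: (f s).
move: ID; congr (is_derive _ _ _ _); apply/funext => s; rewrite /q.
by case: (f s) => a b; rewrite /= mulNr.
Qed.

Lemma has_deriv_prod (I : Type) (r : seq I) (f : I -> R -> R[i]) t :
  (forall i, exists d, has_deriv (f i) t d) ->
  exists d, has_deriv (fun s => \prod_(i <- r) f i s) t d.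
Proof.
move=> hf; elim: r => [|i r [d hd]].
  exists 0; apply: has_deriv_ext (has_deriv_cst 1 t) => s; by rewrite big_nil.
have [e he] := hf i; eexists; apply: has_deriv_ext (has_derivM he hd) => s.
by rewrite big_cons.
Qed.

Lemma is_derive_powR_inv (a t : R) : 0 < t ->
  is_derive t 1 (fun s => (s `^ a)^-1) (- a * t `^ (- a - 1)).
Proof.
move=> t0; have -> : (fun s => (s `^ a)^-1) = (fun s => s `^ (- a)).
  by apply/funext => s; rewrite powRN.
exact: is_derive1_powR.
Qed.

Lemma has_deriv_expi (l t : R) :
  has_deriv (fun s => expi (l * s)) t ('i * l%:C * expi (l * t)).
Proof.
have hl : is_derive t 1 (fun s : R => l * s) l.
  rewrite -[X in is_derive _ _ _ X](mulr1 l); exact: is_deriveZ.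
apply/has_derivP; rewrite /expi /=; split.
  have := is_derive1_comp (is_derive_cos (l * t)) hl.
  by congr (is_derive _ _ _ _); rewrite /GRing.scale/=; ring.
have := is_derive1_comp (is_derive_sin (l * t)) hl.
by congr (is_derive _ _ _ _); rewrite /GRing.scale/=; ring.
Qed.

End HasDeriv.

(** * Differentiable matrices and changes of variables *)

Section MatrixDerivative.
Context {R : realType}.
Local Notation K := R[i].

Definition mx_deriv {m n} (M : R -> 'M[K]_(m, n)) (t : R) (D : 'M[K]_(m, n)) :=
  forall a b, has_deriv (fun s => M s a b) t (D a b).

Lemma mx_deriv_unique m n (M : R -> 'M[K]_(m, n)) t D E :
  mx_deriv M t D -> mx_deriv M t E -> D = E.
Proof. by move=> hD hE; apply/matrixP => a b; exact: has_deriv_unique. Qed.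

Lemma mx_deriv_near m n (M L : R -> 'M[K]_(m, n)) t D :
  (\forall s \near t, M s = L s) -> mx_deriv M t D -> mx_deriv L t D.
Proof.
move=> ML hM a b; apply: has_deriv_near (hM a b).
by apply: filterS ML => s ->.
Qed.

Lemma mx_deriv_cst m n (C : 'M[K]_(m, n)) t : mx_deriv (fun=> C) t 0.
Proof. by move=> a b; rewrite mxE; exact: has_deriv_cst. Qed.

Lemma mx_deriv_sum (I : Type) (r : seq I) m n (M D : I -> R -> 'M[K]_(m, n)) t :
  (forall i, mx_deriv (M i) t (D i t)) ->
  mx_deriv (fun s => \sum_(i <- r) M i s) t (\sum_(i <- r) D i t).
Proof.
move=> hM a b; rewrite summxE.
have h := has_deriv_sum (r := r) (P := xpredT) (fun i _ => hM i a b).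
apply: has_deriv_ext h.
by move=> s; rewrite summxE.
Qed.

Lemma mx_derivM m n p (M : R -> 'M[K]_(m, n)) (L : R -> 'M[K]_(n, p)) t D E :
  mx_deriv M t D -> mx_deriv L t E ->
  mx_deriv (fun s => M s *m L s) t (D *m L t + M t *m E).
Proof.
move=> hM hL a b; rewrite !mxE -big_split/=.
have h := has_deriv_sum (r := index_enum 'I_n) (P := xpredT)
  (fun j _ => has_derivM (hM a j) (hL j b)).
apply: has_deriv_ext h.
by move=> s; rewrite mxE.
Qed.

Lemma mx_derivZ m n (c : R -> K) (M : R -> 'M[K]_(m, n)) t d D :
  has_deriv c t d -> mx_deriv M t D ->
  mx_deriv (fun s => c s *: M s) t (d *: M t + c t *: D).
Proof.
move=> hc hM a b; rewrite !mxE; apply: has_deriv_ext (has_derivM hc (hM a b)).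
by move=> s; rewrite mxE.
Qed.

Lemma det_derivable n (M : R -> 'M[K]_n) t D :
  mx_deriv M t D -> exists d, has_deriv (fun s => \det (M s)) t d.
Proof.
move=> hM.
have h (s : 'S_n) : exists d, has_deriv (fun u => \prod_i M u i (s i)) t d.
  by apply: has_deriv_prod => i; exists (D i (s i)); exact: hM.
have [f hf] := choice h.
eexists; apply: has_deriv_sum => s _.
exact: has_derivM (has_deriv_cst _ _) (hf s).
Qed.

(** By Cramer's rule the entries of the inverse are polynomials in
    the entries of the matrix, divided by the determinant. *)
Lemma invmx_derivable n (M : R -> 'M[K]_n) t D :
  (\forall s \near t, M s \in unitmx) -> mx_deriv M t D ->
  exists E, mx_deriv (fun s => invmx (M s)) t E.
Proof.
move=> uM hM; have [d hd] := det_derivable hM.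
have ut : \det (M t) != 0.
  by have := nbhs_singleton uM; rewrite unitmxE unitfE.
have [e he] := has_derivV ut hd.
have hc (ab : 'I_n * 'I_n) : exists c, has_deriv (fun s => (\adj (M s)) ab.1 ab.2) t c.
  case: ab => a b /=.
  have hm : mx_deriv (fun s => row' b (col' a (M s))) t (row' b (col' a D)).
    move=> i j; rewrite !mxE; apply: has_deriv_ext (hM _ _) => s.
    by rewrite !mxE.
  have [c hc] := det_derivable hm.
  eexists; apply: has_deriv_ext (has_derivM (has_deriv_cst _ _) hc) => s.
  by rewrite mxE.
have [c {}hc] := choice hc.
have hadj : mx_deriv (fun s => \adj (M s)) t (\matrix_(a, b) c (a, b)).
  by move=> a b; rewrite mxE; exact: (hc (a, b)).
eexists; apply: mx_deriv_near (mx_derivZ he hadj).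
by apply: filterS uM => s us; rewrite /invmx us.
Qed.

Lemma solvesE n T (f : R -> 'cV[K]_n -> 'cV[K]_n) x :
  solves T f x <-> forall t, T < t -> mx_deriv x t (f t (x t)).
Proof.
split=> h t Tt a; last by move=> *; exact: h.
by move=> b; rewrite ord1; exact: h.
Qed.

Lemma solves_ext n T (f g : R -> 'cV[K]_n -> 'cV[K]_n) x :
  (forall t v, f t v = g t v) -> solves T f x <-> solves T g x.
Proof. by move=> fg; split=> h t Tt a; have := h t Tt a; rewrite fg. Qed.

(** If y solves its system, the product rule gives (P y)' = P' y + P B y = A P y.
    Conversely y = P^-1 x is differentiable; comparing the product rule for P y
    with x' = A P y gives P y' = P B y, and P cancels. *)
Lemma change_of_variables n T (P P' A B : R -> 'M[K]_n) (x y : R -> 'cV[K]_n) :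
  (forall t, T < t -> mx_deriv P t (P' t)) ->
  (forall t, T < t -> P t \in unitmx) ->
  (forall t, T < t -> A t *m P t = P' t + P t *m B t) ->
  (forall t, T < t -> x t = P t *m y t) ->
  solves T (fun t v => A t *m v) x <-> solves T (fun t v => B t *m v) y.
Proof.
move=> hP uP hAB hxy; rewrite !solvesE.
have near_gt t : T < t -> \forall s \near t, T < s.
  by move=> Tt; have := @open_gt R T; rewrite openE => /(_ t Tt).
split=> h t Tt.
  have [Q' hQ] := invmx_derivable (filterS uP (near_gt t Tt)) (hP t Tt).
  have [d hy] : exists d, mx_deriv y t d.
    eexists; apply: mx_deriv_near (mx_derivM hQ (h t Tt)).
    by apply: filterS (near_gt t Tt) => s Ts; rewrite hxy// mulKmx// uP.
  suff <- : d = B t *m y t by [].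
  have hx : mx_deriv x t (P' t *m y t + P t *m d).
    apply: mx_deriv_near (mx_derivM (hP t Tt) hy).
    by apply: filterS (near_gt t Tt) => s Ts; rewrite hxy.
  have := mx_deriv_unique (h t Tt) hx.
  rewrite hxy// mulmxA hAB// mulmxDl -mulmxA => /addrI /(congr1 (mulmx (invmx (P t)))).
  by rewrite !mulKmx ?uP.
have hx := mx_derivM (hP t Tt) (h t Tt).
have -> : A t *m x t = P' t *m y t + P t *m (B t *m y t).
  by rewrite (hxy t Tt) mulmxA (hAB t Tt) mulmxDl -mulmxA.
apply: mx_deriv_near hx.
by apply: filterS (near_gt t Tt) => s Ts; rewrite hxy.
Qed.

End MatrixDerivative.

(** * Equivalence of matrix norms *)

Section NormEquivalence.
Context {R : realType}.
Local Open Scope classical_set_scope.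
Local Open Scope ring_scope.

Definition real_seminorm m (p : 'rV[R]_m -> R) :=
  (forall u v, p (u + v) <= p u + p v) /\ (forall c u, p (c *: u) = `|c| * p u).

Lemma row_entry_le_norm m (v : 'rV[R]_m) i : `|v 0 i| <= `|v|.
Proof.
rewrite [leRHS]/Num.norm/= mx_normrE.
by rewrite (le_bigmax _ (fun ij : 'I_1 * 'I_m => `|v ij.1 ij.2|) (0, i)).
Qed.

Lemma seminorm_ge0 m (p : 'rV[R]_m -> R) v : real_seminorm p -> 0 <= p v.
Proof.
move=> [pD pZ].
have h0 : p 0 = 0 by rewrite -(scale0r (0 : 'rV[R]_m)) pZ normr0 mul0r.
have hN : p (- v) = p v by rewrite -scaleN1r pZ normrN1 mul1r.
by have := pD v (- v); rewrite subrr h0 hN; lra.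
Qed.

Lemma seminorm_le_norm m (p : 'rV[R]_m -> R) : real_seminorm p ->
  exists2 c, 0 <= c & forall v, p v <= c * `|v|.
Proof.
move=> sp; have p0 v := seminorm_ge0 v sp; have [pD pZ] := sp.
exists (\sum_i p (delta_mx 0 i)); first by rewrite sumr_ge0.
move=> v; rewrite {1}(row_sum_delta v) mulr_suml.
elim/big_ind2: _ => [|x a y b xa yb|i _].
- by rewrite -(scale0r (0 : 'rV[R]_m)) pZ normr0 mul0r.
- by rewrite (le_trans (pD _ _))// lerD.
- by rewrite pZ mulrC ler_wpM2l// row_entry_le_norm.
Qed.

(** Lipschitz continuity, from the reverse triangle inequality. *)
Lemma seminorm_continuous m (p : 'rV[R]_m -> R) :
  real_seminorm p -> continuous p.
Proof.
move=> sp; have [c c0 pc] := seminorm_le_norm sp; case: sp => pD pZ v.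
apply: (proj2 (@cvgrPdist_lt _ _ _ (nbhs v) (nbhs_filter v) p (p v))) => e e0.
have hN u : p (- u) = p u by rewrite -scaleN1r pZ normrN1 mul1r.
have ec : 0 < e / (c + 1) by rewrite divr_gt0// ltr_wpDl.
have vu : \forall u \near nbhs v, `|v - u| < e / (c + 1).
  exact: ((proj1 (@cvgrPdist_lt _ _ _ (nbhs v) (nbhs_filter v) id v)) cvg_id).
apply: filterS vu => u /ltW /(ler_wpM2l c0).
have hc : c * (e / (c + 1)) < e.
  by rewrite mulrCA gtr_pMr// ltr_pdivrMr ?ltr_wpDl// mul1r ltrDl.
have h1 := pD (v - u) u; have h2 := pD (u - v) v.
have h3 : p (u - v) = p (v - u) by rewrite -hN opprB.
rewrite !subrK in h1 h2; have := pc (v - u).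
rewrite ltr_norml; lra.
Qed.

(** On the compact unit sphere of the supremum norm the continuous
    function p has a minimum, positive because p is definite, while q is bounded
    there; homogeneity extends the comparison to the whole space. *)
Lemma seminorm_equiv m (p q : 'rV[R]_m -> R) :
  real_seminorm p -> (forall v, p v = 0 -> v = 0) -> real_seminorm q ->
  exists2 c, 0 <= c & forall v, q v <= c * p v.
Proof.
move=> sp p_def sq; have [cq cq0 qc] := seminorm_le_norm sq.
have [|/existsNP[w w0]] := pselect (forall v : 'rV[R]_m, v = 0).
  move=> v0; exists 0 => // v; have := qc v.
  by rewrite (v0 v) normr0 mulr0 mul0r.
pose S := [set v : 'rV[R]_m | `|v| = 1].
have cS : compact S.
  apply: bounded_closed_compact.
    by exists 1; split => // x x1 v /= ->; exact: ltW.
  apply: (@preimage_closed 'rV[R]_m R Num.norm [set 1 : R]).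
    by move=> v _; exact: norm_continuous.
  exact: closed_eq.
have S0 : S !=set0.
  have {}w0 : w != 0 by apply/eqP.
  exists (`|w|^-1 *: w); rewrite /S/= normrZ normfV normr_id mulVf// normr_eq0//.
have [v0 v0S hmin] := EVT_min_rV S0 cS
  (continuous_subspaceT (seminorm_continuous sp)).
have pv0 : 0 < p v0.
  rewrite lt_def; apply/andP; split.
    apply/eqP => /p_def v00; move: v0S; rewrite inE /S/= v00 normr0 => /eqP.
    by rewrite eq_sym oner_eq0.
  exact: seminorm_ge0.
exists (cq / p v0) => [|v]; first by rewrite divr_ge0// ltW.
have [->|v_neq0] := eqVneq v 0.
  have h := qc 0; rewrite normr0 mulr0 in h.
  apply: (le_trans h); apply: mulr_ge0; last exact: seminorm_ge0.
  by rewrite divr_ge0// ltW.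
have nv0 : 0 < `|v| by rewrite normr_gt0.
have : p v0 <= p (`|v|^-1 *: v).
  by apply: hmin; rewrite inE /S/= normrZ normfV normr_id mulVf// gt_eqF.
rewrite (sp.2) normfV normr_id ler_pdivlMl// => h.
rewrite (le_trans (qc v))// -mulrA ler_wpM2l// ler_pdivlMl//.
by rewrite mulrC.
Qed.

End NormEquivalence.

Section MatrixNormEquivalence.
Context {R : realType}.
Local Notation K := R[i].

(* A complex matrix is the row of the real parts of its entries followed by the
   row of their imaginary parts. *)
Let mx_of_row n (v : 'rV[R]_(n * n + n * n)) : 'M[K]_n :=
  \matrix_(i, j) (vec_mx (lsubmx v) i j +i* vec_mx (rsubmx v) i j).

Let mx_of_row_additive n (u v : 'rV[R]_(n * n + n * n)) :
  mx_of_row (u + v) = mx_of_row u + mx_of_row v.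
Proof. by apply/matrixP => i j; rewrite !mxE. Qed.

Let mx_of_row_scale n (c : R) (u : 'rV[R]_(n * n + n * n)) :
  mx_of_row (c *: u) = c%:C *: mx_of_row u.
Proof.
by apply/matrixP => i j; rewrite !mxE; apply/eqP; rewrite eq_complex/=;
  apply/andP; split; apply/eqP; ring.
Qed.

Let mx_of_row_surj n (A : 'M[K]_n) : exists v, mx_of_row v = A.
Proof.
exists (row_mx (mxvec (map_mx (@complex.Re R) A))
               (mxvec (map_mx (@complex.Im R) A))).
apply/matrixP => i j; rewrite mxE row_mxKl row_mxKr !mxvecK !mxE.
by case: (A i j).
Qed.

Let mx_of_row_eq0 n (v : 'rV[R]_(n * n + n * n)) : mx_of_row v = 0 -> v = 0.
Proof.
move=> /matrixP v0; rewrite -(hsubmxK v) -(vec_mxK (lsubmx v)) -(vec_mxK (rsubmx v)).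
have -> : vec_mx (lsubmx v) = 0.
  by apply/matrixP => i j; have := v0 i j; rewrite !mxE => -[].
have -> : vec_mx (rsubmx v) = 0.
  by apply/matrixP => i j; have := v0 i j; rewrite !mxE => -[].
by rewrite !linear0 row_mx0.
Qed.

Lemma matrix_norm_equiv n (N L : 'M[K]_n -> R) :
  matrix_norm N -> matrix_norm L ->
  exists2 c, 0 <= c & forall A, L A <= c * N A.
Proof.
move=> hN hL.
have sn M : matrix_norm M -> real_seminorm (fun v => M (@mx_of_row n v)).
  move=> hM; split=> [u v|c u]; first by rewrite mx_of_row_additive mxnorm_triangle.
  rewrite mx_of_row_scale; apply: (@complexI R).
  by rewrite mxnorm_scale// normcE_real rmorphM/= expr0n/= addr0 sqrtr_sqr.
have [c c0 h] := seminorm_equiv (sn _ hN)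
  (fun v e => mx_of_row_eq0 (mxnorm_eq0 hN e)) (sn _ hL).
by exists c => // A; have [v <-] := mx_of_row_surj A.
Qed.

End MatrixNormEquivalence.

Section EntrySumNorm.
Context {R : realType}.
Local Notation K := R[i].

(** A norm that is submultiplicative ([norm1M]) and easy to compute with, for
    the estimates of products. *)
Definition norm1 {m n} (A : 'M[K]_(m, n)) : R := \sum_i \sum_j normc (A i j).

Lemma normc_ge0 (z : K) : 0 <= normc z.
Proof. by case: z => a b; rewrite sqrtr_ge0. Qed.

Lemma norm1_ge0 m n (A : 'M[K]_(m, n)) : 0 <= norm1 A.
Proof. by rewrite sumr_ge0// => i _; rewrite sumr_ge0// => j _; exact: normc_ge0. Qed.

Lemma entry_le_norm1 m n (A : 'M[K]_(m, n)) i j : normc (A i j) <= norm1 A.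
Proof.
rewrite /norm1 (bigD1 i)//= (bigD1 j)//= -addrA lerDl addr_ge0//.
  by rewrite sumr_ge0// => l _; exact: normc_ge0.
by rewrite sumr_ge0// => l _; rewrite sumr_ge0// => ? _; exact: normc_ge0.
Qed.

Lemma norm1_eq0 m n (A : 'M[K]_(m, n)) : norm1 A = 0 -> A = 0.
Proof.
move=> A0; apply/matrixP => i j; rewrite mxE; apply: eq0_normc; apply/eqP.
by rewrite eq_le normc_ge0 -{1}A0 entry_le_norm1.
Qed.

Lemma norm1D m n (A B : 'M[K]_(m, n)) : norm1 (A + B) <= norm1 A + norm1 B.
Proof.
rewrite /norm1 -big_split/=; apply: ler_sum => i _.
rewrite -big_split/=; apply: ler_sum => j _.
by rewrite mxE le_normcD.
Qed.

Lemma norm1Z m n c (A : 'M[K]_(m, n)) : norm1 (c *: A) = normc c * norm1 A.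
Proof.
rewrite /norm1 mulr_sumr; apply: eq_bigr => i _.
by rewrite mulr_sumr; apply: eq_bigr => j _; rewrite mxE normcM.
Qed.

Lemma norm1N m n (A : 'M[K]_(m, n)) : norm1 (- A) = norm1 A.
Proof. by rewrite -scaleN1r norm1Z (normcN 1) normc1 mul1r. Qed.

Lemma norm1_is_matrix_norm n : matrix_norm (@norm1 n n).
Proof.
split=> [A|A|c A|A B]; [exact: norm1_ge0|exact: norm1_eq0| |exact: norm1D].
by rewrite norm1Z normcE_real rmorphM.
Qed.

Lemma norm1M m n p (A : 'M[K]_(m, n)) (B : 'M[K]_(n, p)) :
  norm1 (A *m B) <= norm1 A * norm1 B.
Proof.
have hsum (I : Type) (r : seq I) (f : I -> K) :
    normc (\sum_(i <- r) f i) <= \sum_(i <- r) normc (f i).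
  elim/big_ind2: _ => [|x a y b xa yb|//]; first by rewrite normc0.
  by rewrite (le_trans (le_normcD _ _))// lerD.
rewrite {1 2}/norm1 mulr_suml; apply: ler_sum => i _.
have -> : (\sum_j normc (A i j)) * norm1 B =
    \sum_j \sum_k0 normc (A i j) * \sum_l normc (B k0 l).
  by rewrite mulr_suml; apply: eq_bigr => j _; rewrite mulr_sumr.
apply: (@le_trans _ _ (\sum_l \sum_j normc (A i j) * normc (B j l))).
  apply: ler_sum => l _; rewrite mxE (le_trans (hsum _ _ _))//.
  by apply: ler_sum => j _; rewrite normcM.
rewrite exchange_big/=; apply: ler_sum => j _.
rewrite (bigD1 j)//= -mulr_sumr lerDl sumr_ge0// => l _.
by rewrite mulr_ge0 ?normc_ge0// sumr_ge0// => ? _; exact: normc_ge0.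
Qed.

End EntrySumNorm.

(** * The Sylvester equation *)

Section Sylvester.

Lemma horner_mx_intertwine (F : fieldType) n (A B X : 'M[F]_n.+1) (p : {poly F}) :
  A *m X = X *m B -> horner_mx A p *m X = X *m horner_mx B p.
Proof.
move=> AX; elim/poly_ind: p => [|p c IH]; first by rewrite !rmorph0 mul0mx mulmx0.
rewrite !rmorphD !rmorphM/= !horner_mx_X !horner_mx_C mulmxDl mulmxDr.
rewrite -!mulmxE -mulmxA AX !mulmxA IH.
by rewrite mul_scalar_mx mul_mx_scalar.
Qed.

(** With p the characteristic polynomial of A, Cayley-Hamilton gives
    0 = p(A) X = X p(B), and p(B) is a product of factors B - a, with a an
    eigenvalue of A, hence invertible. *)
Lemma sylvester_injective (F : closedFieldType) n (A B X : 'M[F]_n) :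
  (forall a, eigenvalue A a -> ~~ eigenvalue B a) -> A *m X = X *m B -> X = 0.
Proof.
case: n A B X => [|n] A B X sep AX; first by apply/matrixP => -[].
have [r pE] := closed_field_poly_normal (char_poly A).
rewrite (monicP (char_poly_monic A)) scale1r in pE.
have : X *m horner_mx B (char_poly A) = 0.
  by rewrite -(horner_mx_intertwine _ AX) (Cayley_Hamilton A) mul0mx.
have rE a : a \in r -> eigenvalue A a.
  by rewrite eigenvalue_root_char pE root_prod_XsubC.
rewrite {}pE; elim: r X {AX} rE => [|a r IH] X rE.
  by rewrite big_nil rmorph1 mulmx1.
rewrite big_cons rmorphM/= -mulmxE mulmxA => /IH XB.
have {}XB : X *m horner_mx B ('X - a%:P) = 0.
  by apply: XB => b br; apply: rE; rewrite inE br orbT.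
have : B - a%:M \in unitmx.
  rewrite -row_free_unit -kermx_eq0.
  by have := sep a (rE a (mem_head _ _)); rewrite negbK.
rewrite rmorphB/= horner_mx_X horner_mx_C in XB.
by move=> u; rewrite -[X](mulmxK u) XB mul0mx.
Qed.

(** An injective endomorphism of a finite-dimensional space is
    surjective. *)
Lemma sylvester_surjective (F : closedFieldType) n (A B Q : 'M[F]_n) :
  (forall a, eigenvalue A a -> ~~ eigenvalue B a) ->
  exists X, X *m B - A *m X = Q.
Proof.
move=> sep; pose f := mulmxr B \- mulmx A : {linear 'M[F]_n -> 'M[F]_n}.
have uf : lin_mx f \in unitmx.
  rewrite -row_free_unit; apply: inj_row_free => v.
  rewrite -(vec_mxK v) mul_vec_lin => /(congr1 vec_mx).
  rewrite mxvecK linear0/= => /eqP; rewrite subr_eq0 => /eqP/esym.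
  by move=> /(sylvester_injective sep) ->; rewrite linear0.
exists (vec_mx (mxvec Q *m invmx (lin_mx f))).
have := mul_vec_lin f (vec_mx (mxvec Q *m invmx (lin_mx f))).
rewrite vec_mxK mulmxKV// => /(congr1 vec_mx).
by rewrite !mxvecK.
Qed.

(** The equation reads X (A + i l) - A X = Q. A common eigenvalue of
    A and A + i l would be a real number x such that x - i l is real too. *)
Lemma homological_equation_frequency (R : rcfType) n (A Q : 'M[R[i]]_n) (l : R) :
  (forall a : R[i], eigenvalue A a -> a \is Num.real) -> l != 0 ->
  exists X, ('i * l%:C) *: X = A *m X - X *m A + Q.
Proof.
move=> hA l0.
have [|X <-] := @sylvester_surjective _ n A (A + ('i * l%:C)%:M) Q.
  move=> a /hA/complex_realP[x ->]; apply/negP => /eigenvalueP[v vA v0].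
  have /hA : eigenvalue A (x%:C - 'i * l%:C).
    apply/eigenvalueP; exists v => //; rewrite scalerBl -vA mulmxDr.
    by rewrite mul_mx_scalar addrK.
  have -> : x%:C - 'i * l%:C = x +i* (- l).
    by apply/eqP; rewrite eq_complex/=; apply/andP; split; apply/eqP; ring.
  by rewrite complex_real oppr_eq0 (negPf l0).
exists X; rewrite mulmxDr mul_mx_scalar.
move: (A *m X) (X *m A) => U V; apply/matrixP => a b; rewrite !mxE; ring.
Qed.

End Sylvester.

(** * Trigonometric polynomials with matrix coefficients *)

Section TrigonometricMatrices.
Context {R : realType}.
Local Notation K := R[i].

Lemma expiD (x y : R) : expi (x + y) = expi x * expi y.
Proof.
apply/eqP; rewrite eq_complex/= cosD sinD.
by apply/andP; split; apply/eqP; ring.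
Qed.

Lemma expi0 : expi (0 : R) = 1.
Proof. by rewrite /expi cos0 sin0. Qed.

Lemma normc_expi (x : R) : normc (expi x) = 1.
Proof. by rewrite /= cos2Dsin2 sqrtr1. Qed.

Definition mtrig_eval {n} (s : seq ('M[K]_n * R)) (t : R) : 'M[K]_n :=
  \sum_(bl <- s) expi (bl.2 * t) *: bl.1.

(** The same functions as [class_Sigma] (see [class_Sigma_mtrig]), with
    matrix coefficients instead of one list of terms for each entry: in this form
    the homological equation can be solved one frequency at a time. *)
Definition is_mtrig {n} (M : R -> 'M[K]_n) := exists s, M =1 mtrig_eval s.

Lemma is_mtrig_cst n (C : 'M[K]_n) : is_mtrig (fun=> C).
Proof.
by exists [:: (C, 0)] => t; rewrite /mtrig_eval big_seq1 mul0r expi0 scale1r.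
Qed.

Lemma is_mtrigD n (M L : R -> 'M[K]_n) :
  is_mtrig M -> is_mtrig L -> is_mtrig (fun t => M t + L t).
Proof.
move=> [s Ms] [u Lu]; exists (s ++ u) => t.
by rewrite Ms Lu /mtrig_eval big_cat.
Qed.

Lemma is_mtrig_sum n (I : Type) (r : seq I) (M : I -> R -> 'M[K]_n) :
  (forall i, is_mtrig (M i)) -> is_mtrig (fun t => \sum_(i <- r) M i t).
Proof.
move=> hM; elim: r => [|i r [s hs]].
  by exists [::] => t; rewrite /mtrig_eval !big_nil.
have [u hu] := is_mtrigD (hM i) (ex_intro _ s hs).
by exists u => t; rewrite -hu big_cons.
Qed.

Lemma is_mtrigM n (M L : R -> 'M[K]_n) :
  is_mtrig M -> is_mtrig L -> is_mtrig (fun t => M t *m L t).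
Proof.
move=> [s Ms] [u Lu].
exists [seq (x.1 *m y.1, x.2 + y.2) | x <- s, y <- u] => t.
rewrite Ms Lu /mtrig_eval big_allpairs_dep/= mulmx_suml; apply: eq_bigr => x _.
rewrite mulmx_sumr; apply: eq_bigr => y _ /=.
by rewrite mulrDl expiD -scalemxAl -scalemxAr scalerA.
Qed.

Lemma is_mtrigN n (M : R -> 'M[K]_n) : is_mtrig M -> is_mtrig (fun t => - M t).
Proof.
move=> /(is_mtrigM (is_mtrig_cst (- 1%:M))) [s hs].
by exists s => t; rewrite -hs mulNmx mul1mx.
Qed.

Lemma class_Sigma_mtrig n (M : R -> 'M[K]_n) : class_Sigma M <-> is_mtrig M.
Proof.
split=> [hM|[s Ms] a b]; last first.
  exists [seq (bl.1 a b, bl.2) | bl : 'M[K]_n * R <- s] => t.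
  rewrite Ms summxE /trig_eval big_map; apply: eq_bigr => bl _.
  by rewrite mxE mulrC.
have [p hp] := choice (fun ab : 'I_n * 'I_n => hM ab.1 ab.2).
have [s hs] : is_mtrig (fun t => \sum_a \sum_b M t a b *: delta_mx a b).
  apply: is_mtrig_sum => a; apply: is_mtrig_sum => b.
  exists [seq (bl.1 *: delta_mx a b, bl.2) | bl <- p (a, b)] => t.
  rewrite (hp (a, b)) /mtrig_eval /trig_eval big_map scaler_suml.
  by apply: eq_bigr => bl _; rewrite scalerA mulrC.
by exists s => t; rewrite -hs -matrix_sum_delta.
Qed.

Lemma has_mean_mtrig n (s : seq ('M[K]_n * R)) :
  has_mean (mtrig_eval s) (\sum_(bl <- s | bl.2 == 0) bl.1).
Proof.
move=> a b; exists [seq (bl.1 a b, bl.2) | bl : 'M[K]_n * R <- s]; split=> [t|].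
  rewrite summxE /trig_eval big_map; apply: eq_bigr => bl _.
  by rewrite mxE mulrC.
by rewrite /trig_const_term big_map summxE.
Qed.

Lemma mtrig_deriv n (s : seq ('M[K]_n * R)) t :
  mx_deriv (mtrig_eval s) t
    (mtrig_eval [seq (('i * bl.2%:C) *: bl.1, bl.2) | bl <- s] t).
Proof.
rewrite /mtrig_eval big_map.
apply: (mx_deriv_sum (M := fun bl s => expi (bl.2 * s) *: bl.1)
  (D := fun bl t => expi (bl.2 * t) *: (('i * bl.2%:C) *: bl.1))) => bl.
have := mx_derivZ (@has_deriv_expi _ bl.2 t) (mx_deriv_cst bl.1 t).
by rewrite scaler0 addr0 scalerA mulrC.
Qed.

Lemma mtrig_bounded n (M : R -> 'M[K]_n) : is_mtrig M ->
  exists2 c, 0 <= c & forall t, norm1 (M t) <= c.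
Proof.
move=> [s Ms]; exists (\sum_(bl <- s) norm1 bl.1).
  by rewrite sumr_ge0// => bl _; exact: norm1_ge0.
move=> t; rewrite Ms /mtrig_eval; elim/big_ind2: _ => [|x a y b xa yb|bl _].
- by rewrite -(scale0r (0 : 'M[K]_n)) norm1Z normc0 mul0r.
- by rewrite (le_trans (norm1D _ _))// lerD.
- by rewrite norm1Z normc_expi mul1r.
Qed.

(** The constant terms of Q are collected in M, and each term of
    nonzero frequency is solved for separately; Y then has no constant term. *)
Lemma homological_equation n (A : 'M[K]_n) (Q : R -> 'M[K]_n) :
  (forall a : K, eigenvalue A a -> a \is Num.real) -> is_mtrig Q ->
  exists (M : 'M[K]_n) (Y Y' : R -> 'M[K]_n),
    [/\ is_mtrig Y, has_mean Y 0, is_mtrig Y', (forall t, mx_deriv Y t (Y' t)) &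
        forall t, Y' t = A *m Y t - Y t *m A + Q t - M].
Proof.
move=> hA [s Qs].
have hX (bl : 'M[K]_n * R) : exists X, bl.2 != 0 ->
    ('i * bl.2%:C) *: X = A *m X - X *m A + bl.1.
  case: bl => B l /=.
  have [->|l0] := eqVneq l 0; first by exists 0.
  by have [X hX] := homological_equation_frequency B hA l0; exists X.
have [f hf] := choice hX.
pose u := [seq (f bl, bl.2) | bl <- s & bl.2 != 0].
exists (\sum_(bl <- s | bl.2 == 0) bl.1), (mtrig_eval u),
  (mtrig_eval [seq (('i * bl.2%:C) *: bl.1, bl.2) | bl <- u]); split.
- by exists u.
- have := has_mean_mtrig u; rewrite big_map big_filter_cond big_pred0//.
  by move=> bl /=; case: (bl.2 == 0).
- by eexists.
- exact: mtrig_deriv.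
move=> t; rewrite Qs [mtrig_eval s t]/mtrig_eval.
rewrite (bigID (fun bl : 'M[K]_n * R => bl.2 == 0))/=.
(* The terms of frequency zero of Q cancel M; the others match term by term. *)
rewrite [X in _ = _ + (X + _) - _](_ : _ = \sum_(bl <- s | bl.2 == 0) bl.1); last first.
  by apply: eq_bigr => bl /eqP ->; rewrite mul0r expi0 scale1r.
rewrite [X in _ = _ + X - _]addrC addrA addrK.
rewrite /mtrig_eval !big_map !big_filter /= mulmx_sumr mulmx_suml -sumrB -big_split/=.
apply: eq_bigr => bl bl0; rewrite hf// -scalemxAr -scalemxAl.
by rewrite -scalerBr -scalerDr.
Qed.

End TrigonometricMatrices.

(** * Formal solution *)

Section FormalSolution.
Context {R : realType}.
Local Notation K := R[i].

(** Induction on k. The equation of index k+1 involves the unknowns of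
    that index only through A0 Y - Y A0 and - A, and those of smaller index are
    already determined, so that it is an instance of [homological_equation]. *)
Lemma formal_solution n (A0 : 'M[K]_n) (B : nat -> R -> 'M[K]_n) k :
  (forall a : K, eigenvalue A0 a -> a \is Num.real) ->
  (forall t, B 0%N t = A0) ->
  (forall j, (j <= k)%N -> is_mtrig (B j)) ->
  exists (A : nat -> 'M[K]_n) (Y Y' : nat -> R -> 'M[K]_n),
    [/\ A 0%N = A0 /\ (forall t, Y 0%N t = 1%:M),
        forall j, (1 <= j <= k)%N -> has_mean (Y j) 0,
        forall j, is_mtrig (Y j) /\ is_mtrig (Y' j),
        forall j t, mx_deriv (Y j) t (Y' j t) &
        forall j t, (j <= k)%N -> Y' j t =
          \sum_(i < j.+1) (B (j - i)%N t *m Y i t - Y i t *m A (j - i)%N)].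
Proof.
move=> hA B0; elim: k => [|k IH] hB.
  exists (fun=> A0), (fun _ _ => 1%:M), (fun _ _ => 0); split=> //.
  - by case.
  - by move=> j; split; exact: is_mtrig_cst.
  - by move=> j t; exact: mx_deriv_cst.
  - move=> [|//] t _; rewrite big_ord_recl big_ord0 addr0 /= B0.
    by rewrite mulmx1 mul1mx subrr.
have [|A [Y [Y' [[hA0 hY0] hmean htrig hderiv heq]]]] := IH.
  by move=> j jk; apply: hB; exact: leqW.
(* The part of the equation of index k+1 that is already known: the term i = 0
   without its unknown matrix, and the terms 0 < i < k+1. *)
pose Q t := B k.+1 t +
  \sum_(i < k) (B (k - i)%N t *m Y i.+1 t - Y i.+1 t *m A (k - i)%N).
have Qtrig : is_mtrig Q.
  apply: is_mtrigD; first exact: hB.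
  apply: is_mtrig_sum => i; apply: is_mtrigD.
    by apply: is_mtrigM; [apply: hB; rewrite leqW// leq_subr|case: (htrig i.+1)].
  apply: is_mtrigN; apply: is_mtrigM; last exact: is_mtrig_cst.
  by case: (htrig i.+1).
have [M [Z [Z' [Ztrig Zmean Z'trig Zderiv Zeq]]]] := homological_equation hA Qtrig.
pose upd T (f : nat -> T) x j := if j == k.+1 then x else f j.
have updE T (f : nat -> T) x j : (j <= k)%N -> upd T f x j = f j.
  by move=> jk; rewrite /upd ltn_eqF.
have upd_last T (f : nat -> T) x : upd T f x k.+1 = x by rewrite /upd eqxx.
exists (upd _ A M), (upd _ Y Z), (upd _ Y' Z'); split.
- by rewrite !updE.
- move=> j /andP[j1]; rewrite leq_eqVlt ltnS => /orP[/eqP ->|jk].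
    by rewrite upd_last.
  by rewrite updE//; apply: hmean; rewrite j1.
- by move=> j; rewrite /upd; case: eqP.
- by move=> j t; rewrite /upd; case: eqP.
move=> j t; rewrite leq_eqVlt ltnS => /orP[/eqP ->|jk]; last first.
  rewrite updE// heq//; apply: eq_bigr => i _.
  by rewrite !updE// ?(leq_trans _ jk)// ?leq_subr// -ltnS.
rewrite upd_last Zeq big_ord_recl big_ord_recr /= subn0 subnn !upd_last.
rewrite !updE// hY0 mulmx1 mul1mx hA0 B0 /Q.
rewrite (_ : \sum_(i < k) _ = \sum_(i < k)
   (B (k.+1 - bump 0 i)%N t *m upd _ Y Z (bump 0 i) t -
    upd _ Y Z (bump 0 i) t *m upd _ A M (k.+1 - bump 0 i)%N)); last first.
  apply: eq_bigr => i _; rewrite /bump /= add1n subSS !updE ?leq_subr//.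
set S := \sum_(i < k) _; move: S (A0 *m _) (_ *m A0) (B _ _) => S U V W.
by apply/matrixP => a b; rewrite !mxE; ring.
Qed.

End FormalSolution.

Section CauchyProduct.

(** A square of pairs (i, j) is cut along its antidiagonals i + j = m
    with m <= k; what is left are the pairs above the last of them. *)
Lemma cauchy_product_tail (V : zmodType) k (f : nat -> nat -> V) :
  \sum_(j < k.+1) \sum_(i < k.+1) f i j =
  \sum_(m < k.+1) \sum_(j < m.+1) f (m - j)%N j +
  \sum_(j < k.+1) \sum_(i < k.+1 | (k < i + j)%N) f i j.
Proof.
have -> : \sum_(m < k.+1) \sum_(j < m.+1) f (m - j)%N j =
   \sum_(j < k.+1) \sum_(i < k.+1 | ~~ (k < i + j)%N) f i j.
  transitivity (\sum_(m < k.+1) \sum_(j < k.+1 | (j <= m)%N) f (m - j)%N j).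
    by apply: eq_bigr => m _; rewrite (big_ord_widen k.+1 (fun j => f (m - j)%N j)).
  rewrite (exchange_big_dep xpredT)//=; apply: eq_bigr => j _.
  transitivity (\sum_(i < k.+1 - j) f i j).
    rewrite -(big_geq_mkord j k.+1 xpredT (fun m => f (m - j)%N j)).
    rewrite -{1}[nat_of_ord j]add0n big_addn big_mkord.
    by apply: eq_bigr => i _; rewrite addnK.
  rewrite (big_ord_widen k.+1 (fun i => f i j)) ?leq_subr//.
  by apply: eq_bigl => i; rewrite -leqNgt ltn_subRL addnC ltnS.
rewrite -big_split/=; apply: eq_bigr => j _.
by rewrite (bigID (fun i : 'I_k.+1 => (k < i + j)%N))/= addrC.
Qed.

End CauchyProduct.

Section ConjugationResidual.

(** The equations on Y' make the terms with i + j <= k cancel. *)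
Lemma conjugation_residual (F : comPzRingType) n k (w : nat -> F)
    (A B Y Y' : nat -> 'M[F]_n) :
  (forall i j, w (i + j)%N = w i * w j) ->
  (forall j, (j <= k)%N -> Y' j =
    \sum_(i < j.+1) (B (j - i)%N *m Y i - Y i *m A (j - i)%N)) ->
  (\sum_(i < k.+1) w i *: B i) *m (\sum_(j < k.+1) w j *: Y j)
  - \sum_(j < k.+1) w j *: Y' j
  - (\sum_(j < k.+1) w j *: Y j) *m (\sum_(i < k.+1) w i *: A i) =
  \sum_(j < k.+1) \sum_(i < k.+1 | (k < i + j)%N)
     w (i + j)%N *: (B i *m Y j - Y j *m A i).
Proof.
move=> wD hY'.
have := cauchy_product_tail k (fun i j => w (i + j)%N *: (B i *m Y j - Y j *m A i)).
have -> : \sum_(m < k.+1) \sum_(j < m.+1)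
    w (m - j + j)%N *: (B (m - j)%N *m Y j - Y j *m A (m - j)%N) =
    \sum_(j < k.+1) w j *: Y' j.
  apply: eq_bigr => m _; rewrite hY' -1?ltnS// scaler_sumr; apply: eq_bigr => j _.
  by rewrite subnK// -ltnS.
have -> : \sum_(j < k.+1) \sum_(i < k.+1)
    w (i + j)%N *: (B i *m Y j - Y j *m A i) =
  (\sum_(i < k.+1) w i *: B i) *m (\sum_(j < k.+1) w j *: Y j)
  - (\sum_(j < k.+1) w j *: Y j) *m (\sum_(i < k.+1) w i *: A i).
  rewrite mulmx_sumr mulmx_suml -sumrB; apply: eq_bigr => j _.
  rewrite mulmx_suml mulmx_sumr -sumrB; apply: eq_bigr => i _.
  rewrite wD -!scalemxAl -!scalemxAr !scalerA scalerBr.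
  by rewrite [w j * w i]mulrC.
by move=> h; rewrite addrAC h addrC addKr.
Qed.

End ConjugationResidual.

(** * Decay rates *)

Section Decay.
Context {R : realType} (T : R) (T1 : 1 <= T).
Local Notation K := R[i].

(** M(t) = O(t^(-e)), with the range of validity T of the estimate made
    explicit because the conclusion of the theorem names such a T. *)
Definition decays {m n} (e : R) (M : R -> 'M[K]_(m, n)) :=
  exists2 c, 0 <= c & forall t, T <= t -> norm1 (M t) <= c * t `^ (- e).

Let T_gt0 t : T <= t -> 0 < t.
Proof. by move=> Tt; rewrite (lt_le_trans ltr01)// (le_trans T1). Qed.

Let powRD_ge t a b : T <= t -> t `^ (a + b) = t `^ a * t `^ b.
Proof. by move=> /T_gt0 t0; rewrite powRD// (gt_eqF t0); apply/implyP. Qed.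

Lemma decays_bounded m n (M : R -> 'M[K]_(m, n)) c :
  (forall t, T <= t -> norm1 (M t) <= c) -> decays 0 M.
Proof.
move=> h; exists `|c| => // t Tt.
by rewrite oppr0 powRr0 mulr1 (le_trans (h t Tt))// ler_norm.
Qed.

(** For t >= 1 the power t^(-e) is nonincreasing in e. *)
Lemma decays_weaken m n (M : R -> 'M[K]_(m, n)) e e' :
  e' <= e -> decays e M -> decays e' M.
Proof.
move=> ee' [c c0 h]; exists c => // t Tt; rewrite (le_trans (h t Tt))// ler_wpM2l//.
by rewrite ler_powR ?(le_trans T1)// lerN2.
Qed.

Lemma decaysD m n (M L : R -> 'M[K]_(m, n)) e :
  decays e M -> decays e L -> decays e (fun t => M t + L t).
Proof.
move=> [c c0 hM] [d d0 hL]; exists (c + d) => [|t Tt]; first exact: addr_ge0.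
by rewrite (le_trans (norm1D _ _))// mulrDl lerD ?hM ?hL.
Qed.

Lemma decaysN m n (M : R -> 'M[K]_(m, n)) e :
  decays e M -> decays e (fun t => - M t).
Proof. by move=> [c c0 h]; exists c => // t Tt; rewrite norm1N h. Qed.

Lemma decays_sum (I : Type) (r : seq I) (P : pred I) m n
    (M : I -> R -> 'M[K]_(m, n)) e :
  (forall i, P i -> decays e (M i)) ->
  decays e (fun t => \sum_(i <- r | P i) M i t).
Proof.
move=> hM; elim: r => [|i r [c c0 h]].
  exists 0 => // t Tt; rewrite big_nil mul0r.
  by rewrite -(scale0r (0 : 'M[K]_(m, n))) norm1Z normc0 mul0r.
have [Pi|nPi] := boolP (P i); last first.
  by exists c => // t Tt; rewrite big_cons (negPf nPi) h.
have [d d0 h'] := decaysD (hM i Pi) (ex_intro2 _ _ c c0 h).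
by exists d => // t Tt; rewrite big_cons Pi h'.
Qed.

Lemma decaysM m n p (M : R -> 'M[K]_(m, n)) (L : R -> 'M[K]_(n, p)) a b :
  decays a M -> decays b L -> decays (a + b) (fun t => M t *m L t).
Proof.
move=> [c c0 hM] [d d0 hL]; exists (c * d) => [|t Tt]; first exact: mulr_ge0.
rewrite (le_trans (norm1M _ _))// opprD powRD_ge// mulrACA.
by rewrite ler_pM ?norm1_ge0 ?hM ?hL.
Qed.

Lemma decaysZ m n (M : R -> 'M[K]_(m, n)) (w : R -> R) c a b :
  0 <= c -> (forall t, T <= t -> `|w t| <= c * t `^ (- a)) ->
  decays b M -> decays (a + b) (fun t => (w t)%:C *: M t).
Proof.
move=> c0 hw [d d0 hM]; exists (c * d) => [|t Tt]; first exact: mulr_ge0.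
rewrite norm1Z /= expr0n/= addr0 sqrtr_sqr opprD powRD_ge// mulrACA.
by rewrite ler_pM ?norm1_ge0 ?hM ?hw.
Qed.

Lemma decaysZ_powR m n (M : R -> 'M[K]_(m, n)) a b :
  decays b M -> decays (a + b) (fun t => ((t `^ a)^-1)%:C *: M t).
Proof.
apply: (decaysZ (c := 1)) => // t Tt.
by rewrite mul1r powRN ger0_norm// invr_ge0 powR_ge0.
Qed.

Lemma decays_eventually_le m n (M : R -> 'M[K]_(m, n)) a d :
  0 < a -> 0 < d -> decays a M ->
  exists2 t1, T <= t1 & forall t, t1 <= t -> norm1 (M t) <= d.
Proof.
move=> a0 d0 [c c0 h].
(* Beyond (c / d + 1)^(1/a) one has c t^(-a) <= d. *)
exists (Num.max T ((c / d + 1) `^ a^-1)).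
  by rewrite le_max lexx.
move=> t; rewrite ge_max => /andP[Tt ht].
have cd0 : 0 <= c / d by rewrite divr_ge0// ltW.
have t0 := T_gt0 Tt.
apply: (le_trans (h t Tt)); rewrite powRN ler_pdivrMr ?powR_gt0// mulrC.
rewrite -ler_pdivrMr//; apply: (@le_trans _ _ (c / d + 1)); first by rewrite lerDl.
have -> : c / d + 1 = ((c / d + 1) `^ a^-1) `^ a.
  by rewrite -powRrM mulVf ?lt0r_neq0// powRr1// addr_ge0.
by apply: ge0_ler_powR; rewrite ?nnegrE ?powR_ge0 ?(ltW a0) ?(ltW t0).
Qed.

End Decay.

Lemma decays_restrict {R : realType} m n (M : R -> 'M[R[i]]_(m, n)) (T T' e : R) :
  T <= T' -> decays T e M -> decays T' e M.
Proof. by move=> TT' [c c0 h]; exists c => // t Tt; apply: h; exact: le_trans Tt. Qed.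

Section NearIdentity.
Context {R : realType}.
Local Notation K := R[i].

(** A vector v with v (1 + E) = 0 satisfies v = - v E, whose norm is at
    most half that of v. *)
Lemma near_identity_unitmx n (E : 'M[K]_n) :
  norm1 E <= 2^-1 -> 1%:M + E \in unitmx.
Proof.
move=> hE; rewrite -row_free_unit; apply: inj_row_free => v.
rewrite mulmxDr mulmx1 => /eqP; rewrite addr_eq0 => /eqP ve.
apply: norm1_eq0; have := norm1M v E; have := norm1_ge0 v.
rewrite -[X in _ -> X <= _ -> _]norm1N -ve; nra.
Qed.

(** The inverse Q satisfies Q = 1 - Q E, so its norm is at most that
    of 1 plus half its own. *)
Lemma near_identity_invmx n (E : 'M[K]_n) :
  norm1 E <= 2^-1 -> norm1 (invmx (1%:M + E)) <= 2 * norm1 (1%:M : 'M[K]_n).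
Proof.
move=> hE; set Q := invmx _.
have QE : Q = 1%:M - Q *m E.
  have := mulVmx (near_identity_unitmx hE); rewrite -/Q mulmxDr mulmx1 => <-.
  by rewrite addrK.
have h1 := norm1D 1%:M (- (Q *m E)); rewrite -QE norm1N in h1.
have := norm1M Q E; have := norm1_ge0 Q; nra.
Qed.

End NearIdentity.

(** * The theorem *)

Theorem theorem1 (R : realType) (n : nat) (hn : (1 <= n)%N)
  (N : 'M[R[i]]_n -> R) (hN : matrix_norm N)
  (alpha : R) (halpha : 0 < alpha)
  (k : nat) (hk : (0 < k)%N)
  (hk_le : k%:R * alpha <= 1) (hk_gt : 1 < k.+1%:R * alpha)
  (delta : R) (hdelta : 0 < delta) (t0 : R) (ht0 : 0 < t0)
  (A0 : 'M[R[i]]_n) (hA0 : jordan_form A0)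
  (hreal : forall a : R[i], eigenvalue A0 a -> a \is Num.real)
  (At : nat -> R -> 'M[R[i]]_n)
  (hAt : forall j : nat, (1 <= j <= k)%N -> class_Sigma (At j))
  (F : R -> 'M[R[i]]_n) (C : R) (hF : forall t : R, t0 <= t -> N (F t) <= C) :
  exists (A : nat -> 'M[R[i]]_n) (Y : nat -> R -> 'M[R[i]]_n)
    (tstar eps C1 : R) (G : R -> 'M[R[i]]_n),
    [/\ A 0%N = A0 /\ (forall t : R, Y 0%N t = 1%:M),
        forall j : nat, (1 <= j <= k)%N -> class_Sigma (Y j) /\ has_mean (Y j) 0,
        [/\ t0 < tstar, 0 < eps & forall t : R, tstar < t -> N (G t) <= C1] &
        let P (t : R) : 'M[R[i]]_n :=
          \sum_(0 <= j < k.+1) ((t `^ (j%:R * alpha))^-1)%:C *: Y j t in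
        (forall t : R, tstar < t -> P t \in unitmx) /\
        forall x y : R -> 'cV[R[i]]_n,
          (forall t : R, tstar < t -> x t = P t *m y t) ->
          (solves tstar
             (fun t v =>
                (A0 + \sum_(1 <= j < k.+1)
                        ((t `^ (j%:R * alpha))^-1)%:C *: At j t) *m v
                + ((t `^ (1 + delta))^-1)%:C *: (F t *m v)) x
           <->
           solves tstar
             (fun t v =>
                (\sum_(0 <= j < k.+1)
                   ((t `^ (j%:R * alpha))^-1)%:C *: A j) *m v
                + ((t `^ (1 + eps))^-1)%:C *: (G t *m v)) y)].
Proof.
pose B j := if j == 0%N then fun=> A0 else At j.
have Btrig j : (j <= k)%N -> is_mtrig (B j).
  rewrite /B; case: eqP => [_ _|/eqP j0 jk]; first exact: is_mtrig_cst.
  by apply/class_Sigma_mtrig/hAt; rewrite lt0n j0.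
have [A [Y [Y' [[hA00 hY0] Ymean Ytrig Yderiv Yeq]]]] :=
  formal_solution hreal (fun=> erefl) Btrig.
pose w j (t : R) := (t `^ (j%:R * alpha))^-1.
pose P t := \sum_(j < k.+1) (w j t)%:C *: Y j t.
pose d j (t : R) := - (j%:R * alpha) * t `^ (- (j%:R * alpha) - 1).
pose T := Num.max 1 t0.
have T1 : 1 <= T by rewrite le_max lexx.
have Tgt0 t : T <= t -> 0 < t by move=> Tt; rewrite (lt_le_trans ltr01)// (le_trans T1).
(* One constraint for each kind of error term: the derivatives of the weights,
   the products of index beyond k, and F. *)
pose eps := Num.min alpha (Num.min (k.+1%:R * alpha - 1) delta).
have eps0 : 0 < eps by rewrite !lt_min halpha hdelta subr_gt0 hk_gt.
have [eps_alpha eps_k eps_delta] :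
    [/\ 1 + eps <= 1 + alpha, 1 + eps <= k.+1%:R * alpha & 1 + eps <= 1 + delta].
  split; rewrite ?lerD2l ?[1 + eps]addrC -?lerBrDr !ge_min lexx ?orbT//.
pose Drift t := \sum_(j < k.+1) (d j t)%:C *: Y j t.
pose Tail t := \sum_(j < k.+1) \sum_(i < k.+1 | (k < i + j)%N)
     (w (i + j)%N t)%:C *: (B i t *m Y j t - Y j t *m A i).
pose Res t := Tail t - Drift t + ((t `^ (1 + delta))^-1)%:C *: (F t *m P t).
have mtrig_decays M : is_mtrig M -> decays T 0 M.
  by move=> /mtrig_bounded[c _ hc]; apply: (@decays_bounded _ _ _ _ _ c) => t _.
have Pterm_decays j : decays T (j%:R * alpha) (fun t => (w j t)%:C *: Y j t).
  rewrite -[j%:R * alpha]addr0; apply: decaysZ_powR => //.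
  by apply: mtrig_decays; case: (Ytrig j).
have P_decays : decays T 0 P.
  apply: decays_sum => // j _; apply: decays_weaken (Pterm_decays j) => //.
  by rewrite mulr_ge0// ltW.
have Drift_decays : decays T (1 + eps) Drift.
  apply: decays_sum => // j _; apply: (decays_weaken T1 eps_alpha).
  rewrite -[1 + alpha]addr0; apply: (@decaysZ _ _ T1 _ _ _ _ (j%:R * alpha)) => //.
  - by rewrite mulr_ge0// ltW.
  - have ja0 : 0 <= j%:R * alpha by rewrite mulr_ge0// ltW.
    move=> t Tt; rewrite normrM normrN (ger0_norm ja0) (ger0_norm (powR_ge0 _ _)).
    move: ja0.
    (* The weight of index 0 is constant, so it contributes nothing; without
       this its rate would be t^-1, not enough. *)
    case: (nat_of_ord j) => [|l] ja0; first by rewrite !mul0r.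
    rewrite ler_wpM2l // ler_powR ?(le_trans T1)//.
    rewrite opprD addrC lerD2l lerN2 ler_peMl ?(ltW halpha)//.
    by rewrite ler1n.
  - by apply: mtrig_decays; case: (Ytrig j).
have Tail_decays : decays T (1 + eps) Tail.
  apply: decays_sum => // j _; apply: decays_sum => // i ij.
  apply: (@decays_weaken _ _ T1 _ _ _ ((i + j)%:R * alpha + 0)).
    by rewrite addr0 (le_trans eps_k)// ler_wpM2r ?(ltW halpha)// ler_nat.
  apply: decaysZ_powR => //; apply: mtrig_decays; apply: is_mtrigD.
    by apply: is_mtrigM; [apply: Btrig; rewrite -ltnS|case: (Ytrig j)].
  by apply: is_mtrigN; apply: is_mtrigM; [case: (Ytrig j)|exact: is_mtrig_cst].
have [cN cN0 hcN] := matrix_norm_equiv hN (norm1_is_matrix_norm n).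
have [cN' cN'0 hcN'] := matrix_norm_equiv (norm1_is_matrix_norm n) hN.
have F_decays : decays T 0 F.
  apply: (@decays_bounded _ _ _ _ _ (cN * C)) => t Tt.
  by rewrite (le_trans (hcN _))// ler_wpM2l// hF// (le_trans _ Tt)// le_max lexx orbT.
have Res_decays : decays T (1 + eps) Res.
  apply: decaysD => //; first by apply: decaysD => //; exact: decaysN.
  apply: (decays_weaken T1 eps_delta).
  have FP : decays T 0 (fun t => F t *m P t).
    have := decaysM T1 F_decays P_decays; by rewrite addr0.
  have := decaysZ_powR T1 (1 + delta) FP; by rewrite addr0.
pose E t := \sum_(j < k) (w j.+1 t)%:C *: Y j.+1 t.
have PE t : P t = 1%:M + E t.
  rewrite /P big_ord_recl hY0 /w mul0r powRr0 invr1 scale1r.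
  by congr (_ + _); apply: eq_bigr => j _; rewrite lift0.
have E_decays : decays T alpha E.
  apply: decays_sum => // j _; apply: (decays_weaken T1 _ (Pterm_decays j.+1)).
  by rewrite ler_peMl ?(ltW halpha)// ler1n.
have [|t1 Tt1 E_small] := decays_eventually_le T1 halpha _ E_decays (d := 2^-1).
  by rewrite invr_gt0.
have t1_ge1 := le_trans T1 Tt1.
have Punit t : t1 <= t -> P t \in unitmx.
  by move=> tt1; rewrite PE near_identity_unitmx// E_small.
have [cG cG0 hG] : decays t1 (0 + (1 + eps)) (fun t => invmx (P t) *m Res t).
  apply: decaysM => //; last exact: decays_restrict Res_decays.
  apply: decays_bounded => t tt1; rewrite PE; exact: near_identity_invmx (E_small t tt1).
pose G t := (t `^ (1 + eps))%:C *: (invmx (P t) *m Res t).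
pose P' t := Drift t + \sum_(j < k.+1) (w j t)%:C *: Y' j t.
have P_deriv t : T <= t -> mx_deriv P t (P' t).
  move=> Tt; rewrite /P' /Drift -big_split/=.
  apply: (mx_deriv_sum (M := fun (j : 'I_k.+1) t => (w j t)%:C *: Y j t)
    (D := fun (j : 'I_k.+1) t => (d j t)%:C *: Y j t + (w j t)%:C *: Y' j t)) => j.
  apply: mx_derivZ => //; apply: has_deriv_real.
  exact: is_derive_powR_inv (Tgt0 _ Tt).
pose Bsys t := \sum_(i < k.+1) (w i t)%:C *: B i t.
pose Asys t := \sum_(i < k.+1) (w i t)%:C *: A i.
have conj_eq t : T <= t ->
    Bsys t *m P t - \sum_(j < k.+1) (w j t)%:C *: Y' j t - P t *m Asys t = Tail t.
  move=> Tt; have wD i j : (w (i + j)%N t)%:C = (w i t)%:C * (w j t)%:C.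
    rewrite -rmorphM /w natrD mulrDl powRD ?invfM//.
    by rewrite (gt_eqF (Tgt0 _ Tt)); apply/implyP.
  exact (conjugation_residual (w := fun j => (w j t)%:C) (B := B ^~ t)
    (Y := Y ^~ t) wD (fun j => Yeq j t)).
have tt1 t : t1 + 1 < t -> t1 <= t by move=> h; apply: ltW; apply: lt_trans h; rewrite ltrDl.
(* The shift by 1 makes the inequality t0 < t1 + 1 strict. *)
exists A, Y, (t1 + 1), eps, (cN' * cG), G; split.
- by [].
- move=> j jk; split; last exact: Ymean.
  by apply/class_Sigma_mtrig; case: (Ytrig j).
- split=> // [|t /tt1 t1t].
    have t0t1 : t0 <= t1 by rewrite (le_trans _ Tt1)// le_max lexx orbT.
    by rewrite (le_lt_trans t0t1)// ltrDl.
  rewrite (le_trans (hcN' _))// ler_wpM2l// norm1Z /= expr0n/= addr0 sqrtr_sqr.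
  rewrite ger0_norm ?powR_ge0//.
  have tp0 : 0 < t `^ (1 + eps) by rewrite powR_gt0// Tgt0// (le_trans Tt1).
  have := hG t t1t; rewrite add0r powRN => /(ler_wpM2l (ltW tp0)).
  by rewrite mulrCA divff ?mulr1// gt_eqF.
have PsE t : \sum_(0 <= j < k.+1) ((t `^ (j%:R * alpha))^-1)%:C *: Y j t = P t.
  by rewrite big_mkord.
split=> [t /tt1 t1t|x y hxy]; first by rewrite PsE Punit.
apply: (iff_trans (B := solves (t1 + 1) (fun t v =>
  (Bsys t + ((t `^ (1 + delta))^-1)%:C *: F t) *m v) x)).
  apply: solves_ext => t v; rewrite [RHS]mulmxDl -scalemxAl.
  congr (_ *m _ + _).
  rewrite /Bsys big_ord_recl /w mul0r powRr0 invr1 scale1r; congr (_ + _).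
  by rewrite big_add1 big_mkord; apply: eq_bigr => j _; rewrite lift0.
apply: (iff_trans (B := solves (t1 + 1) (fun t v =>
  (Asys t + ((t `^ (1 + eps))^-1)%:C *: G t) *m v) y)); last first.
  by apply: solves_ext => t v; rewrite [LHS]mulmxDl -scalemxAl big_mkord.
apply: (change_of_variables (P := P) (P' := P')) => t lt_t; have t1t := tt1 t lt_t.
- by apply: P_deriv; exact: le_trans t1t.
- exact: Punit.
- have Tt := le_trans Tt1 t1t.
  rewrite mulmxDl mulmxDr -scalemxAl -scalemxAr /G -scalemxAr scalerA -rmorphM.
  rewrite mulVf ?scale1r ?mulKVmx ?Punit//; last by rewrite gt_eqF// powR_gt0// Tgt0.
  rewrite /Res -(conj_eq t Tt) /P'.
  (* With P^-1 cancelled, the identity is the definition of the remainder. *)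
  move: (Bsys t *m _) (P t *m _) (\sum_(j < k.+1) _) (_ *: _) => U V S W.
  by apply/matrixP => a b; rewrite !mxE; ring.
- by rewrite -PsE; exact: hxy.
Qed.
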